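(* All minimal surfaces have the same (universal) bending content. Precisely: let $\Omega\subset\mathbb{C}$ be open and simply connected, regarded as a subset of the $(\bm{e}_1,\bm{e}_2)$ plane through $w=u+iv\leftrightarrow u\bm{e}_1+v\bm{e}_2$, and let $\bm{r}$ be the minimal surface represented on $\Omega$ through the Weierstrass representation by a holomorphic function $F=\mathrm{e}^{\Phi+i\chi}$. Let $\mathbf{R}_{\bm{r}}$ be the rotation in the polar decomposition $\nabla\bm{r}=\mathbf{R}_{\bm{r}}\mathbf{U}_{\bm{r}}$. Then, at every point of $\Omega$ where $1+\operatorname{tr}\mathbf{R}_{\bm{r}}\neq0$, the bending content of $\bm{r}$ is $$\bm{b}_{\bm{r}}=\frac{1}{u^2+v^2}\,(-v\,\bm{e}_1+u\,\bm{e}_2),$$ which is independent of both $\Phi$ and $\chi$, that is, of $F$.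
   Context: $(\bm{e}_1,\bm{e}_2,\bm{e}_3)$ is a positively oriented orthonormal frame. The Weierstrass representation associates with a nowhere vanishing holomorphic function $F$ on $\Omega$ the minimal surface (to within a translation) $$\bm{r}(w)=\Re\Big(\tfrac12\int(1-w^2)F(w)\,\mathrm{d}w\,\bm{e}_1+\tfrac{i}{2}\int(1+w^2)F(w)\,\mathrm{d}w\,\bm{e}_2+\int wF(w)\,\mathrm{d}w\,\bm{e}_3\Big),\qquad w=u+iv.$$ It is regarded as a deformation of the flat reference configuration $\Omega$, with gradient $\nabla\bm{r}=\partial_u\bm{r}\otimes\bm{e}_1+\partial_v\bm{r}\otimes\bm{e}_2=\mathbf{R}_{\bm{r}}\mathbf{U}_{\bm{r}}$, where $\mathbf{R}_{\bm{r}}$ is a rotation in $\mathsf{SO}(3)$ and $\mathbf{U}_{\bm{r}}$ is symmetric, annihilates $\bm{e}_3$ and is positive definite on the $(\bm{e}_1,\bm{e}_2)$ plane. Vector representation of rotations: for a vector $\bm{a}$ with $a^2=\bm{a}\cdot\bm{a}$, $\mathbf{R}(\bm{a})=\frac{1}{1+a^2}\{(1-a^2)\mathbf{I}+2\bm{a}\otimes\bm{a}+2\mathbf{W}(\bm{a})\}$, where $\mathbf{W}(\bm{a})\bm{v}=\bm{a}\times\bm{v}$. Every rotation $\mathbf{R}$ with $1+\operatorname{tr}\mathbf{R}\neq0$ (i.e. not a rotation by $\pi$) is $\mathbf{R}(\bm{a})$ for exactly one $\bm{a}$, determined by $\mathbf{W}(\bm{a})=(\mathbf{R}-\mathbf{R}^{\mathsf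 T})/(1+\operatorname{tr}\mathbf{R})$. If $\bm{a}_{\bm{r}}$ is the vector of $\mathbf{R}_{\bm{r}}$, the bending content of $\bm{r}$ is $$\bm{b}_{\bm{r}}=\frac{1}{1+(\bm{a}_{\bm{r}}\cdot\bm{e}_3)^2}\{\mathbf{I}+(\bm{a}_{\bm{r}}\cdot\bm{e}_3)\mathbf{W}(\bm{e}_3)\}(\mathbf{I}-\bm{e}_3\otimes\bm{e}_3)\bm{a}_{\bm{r}};$$ equivalently, $\mathbf{R}_{\bm{r}}=\mathbf{R}(\bm{b}_{\bm{r}})\mathbf{R}(\bm{d}_{\bm{r}})$ with $\bm{d}_{\bm{r}}$ parallel to $\bm{e}_3$ and $\bm{b}_{\bm{r}}$ orthogonal to $\bm{e}_3$. *)

(* Defs.v *)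
From mathcomp Require Import all_boot all_order all_algebra.
From mathcomp Require Import all_classical all_reals all_analysis.
From mathcomp Require Import complex.

Set Implicit Arguments.
Unset Strict Implicit.
Unset Printing Implicit Defensive.

Import Order.TTheory GRing.Theory Num.Theory.
Import numFieldNormedType.Exports.
Local Open Scope ring_scope.
Local Open Scope classical_set_scope.
Local Open Scope complex_scope.

(* The topology and the normed structure over R[i] are found on the regular
   module R[i]^o, not on R[i] itself; a point w = u + i v of the reference
   plane is u +i* v. *)
Notation CC R := (R[i]^o).

Section ComplexAnalysis.
Variable R : realType.

Definition path_connected (A : set (CC R)) : Prop :=
  forall x y : CC R, A x -> A y ->
    exists gamma : R -> CC R,
      [/\ {within `[0, 1], continuous gamma},
          forall t, 0 <= t <= 1 -> A (gamma t),
          gamma 0 = x & gamma 1 = y].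

(* H (s, _) is the loop at stage s of the homotopy. *)
Definition contractible_loop (A : set (CC R)) (gamma : R -> CC R) : Prop :=
  exists H : R * R -> CC R,
    [/\ {within `[0, 1] `*` `[0, 1], continuous H},
        forall s t, 0 <= s <= 1 -> 0 <= t <= 1 -> A (H (s, t)),
        forall t, 0 <= t <= 1 -> H (0, t) = gamma t /\ H (1, t) = gamma 0 &
        forall s, 0 <= s <= 1 -> H (s, 0) = gamma 0 /\ H (s, 1) = gamma 0].

Definition simply_connected (A : set (CC R)) : Prop :=
  path_connected A /\
  forall gamma : R -> CC R,
    {within `[0, 1], continuous gamma} ->
    (forall t, 0 <= t <= 1 -> A (gamma t)) ->
    gamma 0 = gamma 1 ->
    contractible_loop A gamma.

(* Both derivatives are taken over the field R[i], hence are complex ones. *)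
Definition holomorphic_on (A : set (CC R)) (f : CC R -> CC R) : Prop :=
  forall w, A w -> derivable f w 1.

Definition primitive_on (A : set (CC R)) (G f : CC R -> CC R) : Prop :=
  forall w, A w -> is_derive w 1 G (f w).

Definition cexp (z : R[i]) : R[i] :=
  (expR (complex.Re z))%:C * (cos (complex.Im z) +i* sin (complex.Im z)).

End ComplexAnalysis.

Section Vectors.
Variable R : realType.
Implicit Types (a b v e : 'cV[R]_3) (M Q U : 'M[R]_3).

Definition dot a b : R := (a^T *m b) 0 0.

Definition tensor a b : 'M[R]_3 := a *m b^T.

(* The indices i + 1 and i + 2 are computed modulo 3, in the ring 'I_3. *)
Definition cross a b : 'cV[R]_3 :=
  \col_(i < 3) (a (i + 1) 0 * b (i + 2) 0 - a (i + 2) 0 * b (i + 1) 0).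

(* W a is the matrix of v |-> cross a v. *)
Definition W a : 'M[R]_3 := \matrix_(i, j) cross a (delta_mx j 0) i 0.

Definition positive_orthonormal_frame e1 e2 e3 : Prop :=
  [/\ dot e1 e1 = 1, dot e2 e2 = 1 & dot e3 e3 = 1] /\
  [/\ dot e1 e2 = 0, dot e1 e3 = 0 & dot e2 e3 = 0] /\
  0 < dot (cross e1 e2) e3.

Definition rotation Q : Prop := Q^T *m Q = 1%:M /\ \det Q = 1.

Definition rotation_of a : 'M[R]_3 :=
  (1 + dot a a)^-1 *:
    ((1 - dot a a)%:M + 2 *: tensor a a + 2 *: W a).

(* Meaningful when Q is a rotation with 1 + \tr Q != 0, in which case there is
   exactly one such a. *)
Definition rotation_vector Q : 'cV[R]_3 := get [set a | rotation_of a = Q].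

Definition planar_stretch e3 U : Prop :=
  [/\ U^T = U, U *m e3 = 0 &
      forall v, dot v e3 = 0 -> v != 0 -> 0 < dot v (U *m v)].

(* The rotation of the polar decomposition M = Q U. *)
Definition polar_rotation e3 M : 'M[R]_3 :=
  get [set Q | rotation Q /\ exists U, planar_stretch e3 U /\ M = Q *m U].

Definition bending_part e3 a : 'cV[R]_3 :=
  (1 + dot a e3 ^+ 2)^-1 *:
    ((1%:M + dot a e3 *: W e3) *m ((1%:M - tensor e3 e3) *m a)).

End Vectors.

Section Surfaces.
Variable R : realType.
Implicit Types (e : 'cV[R]_3) (r : CC R -> 'cV[R]_3).

Definition gradient e1 e2 r (w : CC R) : 'M[R]_3 :=
  let u := complex.Re w in
  let v := complex.Im w in
  tensor (derive1 (fun t : R => r (t +i* v)) u) e1 +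
  tensor (derive1 (fun t : R => r (u +i* t)) v) e2.

Definition surface_rotation e1 e2 e3 r (w : CC R) : 'M[R]_3 :=
  polar_rotation e3 (gradient e1 e2 r w).

Definition bending_content e1 e2 e3 r (w : CC R) : 'cV[R]_3 :=
  bending_part e3 (rotation_vector (surface_rotation e1 e2 e3 r w)).

(* The indefinite integrals of the Weierstrass representation are arbitrary
   complex primitives: their constants account for the translation of r. *)
Definition weierstrass_surface (Omega : set (CC R)) (F : CC R -> CC R)
    e1 e2 e3 r : Prop :=
  exists G1 G2 G3 : CC R -> CC R,
    [/\ primitive_on Omega G1 (fun w => (1 - w ^+ 2) * F w),
        primitive_on Omega G2 (fun w => (1 + w ^+ 2) * F w),
        primitive_on Omega G3 (fun w => w * F w) &
        forall w, Omega w ->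
          r w = complex.Re (2^-1 * G1 w) *: e1
              + complex.Re ('i%C / 2 * G2 w) *: e2
              + complex.Re (G3 w) *: e3].

End Surfaces.

(* Main.v *)
Require Import Defs.
From mathcomp Require Import all_boot all_order all_algebra.
From mathcomp Require Import all_classical all_reals all_analysis.
From mathcomp Require Import complex.
From mathcomp Require Import ring lra.

Set Implicit Arguments.
Unset Strict Implicit.
Unset Printing Implicit Defensive.

Import Order.TTheory GRing.Theory Num.Theory.
Import numFieldNormedType.Exports.
Local Open Scope ring_scope.
Local Open Scope classical_set_scope.
Local Open Scope complex_scope.

(** The bending content only sees where the rotation sends [e3].  Write
    a rotation as [rotation_of a], put n := rotation_of a *m e3, and let n1, n2,
    n3 be the coordinates of n in the frame.  Expanding the quotient formulas
    gives 1 + n3 = 2 (1 + a3^2) / (1 + |a|^2), and the bending part of a is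
    (- n2 e1 + n1 e2) / (1 + n3): this is [bending_part_rotation].

    For a Weierstrass surface, n is the unit normal.  The partial derivatives p
    and q of r at w = u + i v are orthogonal and of the same length
    |F(w)| (1 + |w|^2) / 2 > 0.  Hence the stretch is this length times the
    projection on the plane of e1 and e2 ([stretch_eigen], uniqueness of
    positive square roots), the rotation sends e1 and e2 to the normalised p
    and q, and it sends e3 to their cross product ([conformal_polar]).  In this product F
    contributes only its squared modulus, which the normalisation removes, and
    what is left is the inverse stereographic projection
    n = (2 u, 2 v, |w|^2 - 1) / (1 + |w|^2) ([surface_rotation_normal]).
    Thus 1 + n3 = 2 |w|^2 / (1 + |w|^2), and the bending content is
    (- v e1 + u e2) / |w|^2.

    Two existence statements support this, since the polar rotation and the
    rotation vector are chosen elements of sets that might be empty: a polar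
    decomposition is exhibited in [conformal_polar], and a rotation Q with
    1 + tr Q <> 0 has a rotation vector by the Cayley transform
    ([rotation_has_vector]).  At w = 0, where Q e3 = - e3, the trace of Q is
    - 1: this is how the condition on the trace makes |w|^2 nonzero. *)

(** * Vectors and matrices in dimension three *)

Section Coordinates.
Variable R : realType.
Implicit Types (a b c x y : 'cV[R]_3) (M N Q U : 'M[R]_3).

Lemma sum_ord3 (V : nmodType) (f : 'I_3 -> V) : \sum_i f i = f 0 + f 1 + f 2.
Proof.
rewrite !big_ord_recl big_ord0 addr0 addrA.
by congr (_ + f _ + f _); apply/val_inj.
Qed.

Lemma ord3P (P : 'I_3 -> Prop) : P 0 -> P 1 -> P 2 -> forall i, P i.
Proof.
move=> P0 P1 P2 [[|[|[|//]]] lti].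
- by rewrite (_ : Ordinal lti = 0) //; apply/val_inj.
- by rewrite (_ : Ordinal lti = 1) //; apply/val_inj.
- by rewrite (_ : Ordinal lti = 2) //; apply/val_inj.
Qed.

Lemma colvec3P a b :
  a 0 0 = b 0 0 -> a 1 0 = b 1 0 -> a 2 0 = b 2 0 -> a = b.
Proof. by move=> *; apply/matrixP => i j; rewrite ord1; elim/ord3P: i. Qed.

(** Unlike [mxE], these rules leave the entries of [cross a b] folded, so that
    [crossE] can expand them with their indices reduced modulo 3. *)
Lemma coordE :
  (forall a b i, (a + b) i 0 = a i 0 + b i 0) *
  (forall a i, (- a) i 0 = - a i 0) *
  (forall k a i, (k *: a) i 0 = k * a i 0) *
  (forall i, (0 : 'cV[R]_3) i 0 = 0).
Proof. by repeat split=> *; rewrite mxE. Qed.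

Lemma dotE a b : dot a b = a 0 0 * b 0 0 + a 1 0 * b 1 0 + a 2 0 * b 2 0.
Proof. by rewrite /dot mxE sum_ord3 !mxE. Qed.

Lemma crossE a b :
  (cross a b 0 0 = a 1 0 * b 2 0 - a 2 0 * b 1 0) *
  (cross a b 1 0 = a 2 0 * b 0 0 - a 0 0 * b 2 0) *
  (cross a b 2 0 = a 0 0 * b 1 0 - a 1 0 * b 0 0).
Proof.
split; [split|]; rewrite mxE; congr (a _ _ * b _ _ - a _ _ * b _ _);
  exact/val_inj.
Qed.

Lemma mulmx3E m n (A : 'M[R]_(m, 3)) (B : 'M[R]_(3, n)) i j :
  (A *m B) i j = A i 0 * B 0 j + A i 1 * B 1 j + A i 2 * B 2 j.
Proof. by rewrite mxE sum_ord3. Qed.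

Lemma det3E M :
  \det M = M 0 0 * (M 1 1 * M 2 2 - M 1 2 * M 2 1)
         - M 0 1 * (M 1 0 * M 2 2 - M 1 2 * M 2 0)
         + M 0 2 * (M 1 0 * M 2 1 - M 1 1 * M 2 0).
Proof.
(* Indexing by nat lets the nested lifts of the minors compute. *)
have [f Mf] : exists f : nat -> nat -> R, forall i j, M i j = f i j.
  by exists (fun i j => M (inord i) (inord j)) => i j; rewrite !inord_val.
rewrite !(expand_det_row _ 0) sum_ord3 /cofactor !(expand_det_row _ 0).
rewrite !big_ord_recl !big_ord0 /cofactor !det_mx11 !mxE !Mf /= /bump /=.
ring.
Qed.

Lemma WE a :
  (W a 0 0 = 0) * (W a 0 1 = - a 2 0) * (W a 0 2 = a 1 0) *
  (W a 1 0 = a 2 0) * (W a 1 1 = 0) * (W a 1 2 = - a 0 0) *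
  (W a 2 0 = - a 1 0) * (W a 2 1 = a 0 0) * (W a 2 2 = 0).
Proof. by repeat split; rewrite mxE crossE !mxE /=; ring. Qed.

Lemma W_mul a x : W a *m x = cross a x.
Proof. by apply: colvec3P; rewrite mulmx3E !WE crossE; ring. Qed.

Lemma dotC a b : dot a b = dot b a.
Proof. by rewrite !dotE; ring. Qed.

Lemma dotDl a b c : dot (a + b) c = dot a c + dot b c.
Proof. by rewrite /dot linearD mulmxDl mxE. Qed.

Lemma dotZl k a b : dot (k *: a) b = k * dot a b.
Proof. by rewrite /dot linearZ /= -scalemxAl mxE. Qed.

Lemma dotDr a b c : dot c (a + b) = dot c a + dot c b.
Proof. by rewrite /dot mulmxDr mxE. Qed.

Lemma dotZr k a b : dot b (k *: a) = k * dot b a.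
Proof. by rewrite /dot -scalemxAr mxE. Qed.

Lemma dotNl a b : dot (- a) b = - dot a b.
Proof. by rewrite -scaleN1r dotZl mulN1r. Qed.

Lemma dotNr a b : dot b (- a) = - dot b a.
Proof. by rewrite -scaleN1r dotZr mulN1r. Qed.

Lemma dot_mul M a b : dot (M *m a) b = dot a (M^T *m b).
Proof. by rewrite /dot trmx_mul mulmxA. Qed.

Lemma dot_gt0 a : a != 0 -> 0 < dot a a.
Proof.
apply: contra_neqT; rewrite -leNgt dotE -!expr2 => le0.
apply: colvec3P; rewrite mxE; apply/eqP; rewrite -sqrf_eq0; apply/eqP; nra.
Qed.

Lemma crossDl a b c : cross (a + b) c = cross a c + cross b c.
Proof. by apply: colvec3P; rewrite !(coordE, crossE); ring. Qed.

Lemma crossZl k a b : cross (k *: a) b = k *: cross a b.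
Proof. by apply: colvec3P; rewrite !(coordE, crossE); ring. Qed.

Lemma crossDr a b c : cross c (a + b) = cross c a + cross c b.
Proof. by apply: colvec3P; rewrite !(coordE, crossE); ring. Qed.

Lemma crossZr k a b : cross b (k *: a) = k *: cross b a.
Proof. by apply: colvec3P; rewrite !(coordE, crossE); ring. Qed.

Lemma crossC a b : cross a b = - cross b a.
Proof. by apply: colvec3P; rewrite !(coordE, crossE); ring. Qed.

Lemma cross_self a : cross a a = 0.
Proof. by apply: colvec3P; rewrite !(coordE, crossE); ring. Qed.

Lemma tensor_mul a b x : tensor a b *m x = dot b x *: a.
Proof.
by apply/matrixP => i j; rewrite -mulmxA ord1 !mxE big_ord1 /dot mulrC.
Qed.

(** * Rotations and positively oriented orthonormal frames *)

Definition cols a b c : 'M[R]_3 :=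
  \matrix_(i, j) (if j == 0 then a i 0 else if j == 1 then b i 0 else c i 0).

Lemma cols_col M : cols (col 0 M) (col 1 M) (col 2 M) = M.
Proof. by apply/matrixP => i; elim/ord3P; rewrite !mxE. Qed.

Lemma det_cols a b c : \det (cols a b c) = dot (cross a b) c.
Proof. by rewrite det3E dotE !crossE !mxE /=; ring. Qed.

Lemma mul_cols M a b c : M *m cols a b c = cols (M *m a) (M *m b) (M *m c).
Proof. by apply/matrixP => i; elim/ord3P; rewrite !mxE !sum_ord3 !mxE. Qed.

Lemma cols_mul_tr a b c x y z :
  cols a b c *m (cols x y z)^T = tensor a x + tensor b y + tensor c z.
Proof.
by apply/matrixP => i j; rewrite mxE sum_ord3 !mxE !big_ord1 !mxE.
Qed.

Lemma tr_cols_mul a b c :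
  (cols a b c)^T *m cols a b c =
  \matrix_(i, j) dot (if i == 0 then a else if i == 1 then b else c)
                     (if j == 0 then a else if j == 1 then b else c).
Proof.
by apply/matrixP; elim/ord3P; elim/ord3P; rewrite mxE sum_ord3 !mxE dotE /=.
Qed.

(** The Gram matrix of the columns is the identity, so that the determinant,
    which is the triple product of the columns, squares to 1: its sign
    decides. *)
Lemma frame_rotation a b c :
  positive_orthonormal_frame a b c <-> rotation (cols a b c).
Proof.
rewrite /rotation tr_cols_mul det_cols; split.
  move=> [[aa bb cc] [[ab ac bc] pos]].
  have gram : (cols a b c)^T *m cols a b c = 1%:M.
    rewrite tr_cols_mul; apply/matrixP; elim/ord3P; elim/ord3P;
      by rewrite !mxE /= ?(dotC b a) ?(dotC c a) ?(dotC c b).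
  split; first by rewrite -tr_cols_mul.
  have := congr1 determinant gram; rewrite det_mulmx det_tr det1 det_cols.
  by move=> sq; nra.
move=> [/matrixP gram det1].
have g i j := etrans (esym (mxE _ _ i j)) (gram i j).
have := (g 0 0, g 1 1, g 2 2, (g 0 1, g 0 2, g 1 2)).
rewrite !mxE /= => -[[[aa bb] cc] [[ab ac] bc]].
by rewrite /positive_orthonormal_frame det1 ltr01.
Qed.

Lemma frame_cycle a b c : positive_orthonormal_frame a b c ->
  positive_orthonormal_frame b c a.
Proof.
move=> [[aa bb cc] [[ab ac bc] pos]]; split=> //; split.
  by split=> //; rewrite dotC.
by move: pos; congr (_ < _); rewrite !dotE !crossE; ring.
Qed.

(** By Lagrange's identity |a x b| = 1, and (a x b) . c = 1 by
    [frame_rotation]; hence |a x b - c|^2 = 1 - 2 + 1 = 0. *)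
Lemma frame_cross a b c : positive_orthonormal_frame a b c -> cross a b = c.
Proof.
move=> f; have /frame_rotation [_] := f; rewrite det_cols => det1.
have [[aa bb cc] [[ab ac bc] _]] := f.
have lagrange : dot (cross a b) (cross a b)
    = dot a a * dot b b - dot a b ^+ 2 by rewrite !dotE !crossE; ring.
apply/eqP; rewrite -subr_eq0; apply: contraT => /dot_gt0.
rewrite !(dotDl, dotDr, dotNl, dotNr) (dotC c) lagrange.
by rewrite det1 aa bb cc ab; lra.
Qed.

Lemma orthonormal_pair_frame x y : dot x x = 1 -> dot y y = 1 -> dot x y = 0 ->
  positive_orthonormal_frame x y (cross x y).
Proof.
move=> xx yy xy.
have lagrange : dot (cross x y) (cross x y) = 1.
  rewrite (_ : dot (cross x y) _ = dot x x * dot y y - dot x y ^+ 2).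
    by rewrite xx yy xy; ring.
  by rewrite !dotE !crossE; ring.
split; split=> //; last by rewrite lagrange ltr01.
by split=> //; rewrite !dotE !crossE; ring.
Qed.

Lemma frame_complete a b c : positive_orthonormal_frame a b c ->
  tensor a a + tensor b b + tensor c c = 1%:M.
Proof.
move=> /frame_rotation [gram _]; rewrite -cols_mul_tr; exact: mulmx1C.
Qed.

Lemma frame_expand a b c x : positive_orthonormal_frame a b c ->
  x = dot a x *: a + dot b x *: b + dot c x *: c.
Proof.
by move=> /frame_complete e; rewrite -[LHS]mul1mx -e !mulmxDl !tensor_mul.
Qed.

Lemma rotation_mul Q M : rotation Q -> rotation M -> rotation (Q *m M).
Proof.
move=> [QQ dQ] [MM dM]; split; last by rewrite det_mulmx dQ dM mulr1.
by rewrite trmx_mul mulmxA -(mulmxA _ _ Q) QQ mulmx1.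
Qed.

Lemma rotation_tr Q : rotation Q -> rotation Q^T.
Proof. by move=> [QQ dQ]; rewrite /rotation trmxK det_tr (mulmx1C QQ). Qed.

Lemma rotation_frame Q a b c : rotation Q -> positive_orthonormal_frame a b c ->
  positive_orthonormal_frame (Q *m a) (Q *m b) (Q *m c).
Proof.
by move=> rQ /frame_rotation rM; apply/frame_rotation; rewrite -mul_cols;
  apply: rotation_mul.
Qed.

Lemma frame_to_frame a b c x y z :
  positive_orthonormal_frame a b c -> positive_orthonormal_frame x y z ->
  rotation (tensor x a + tensor y b + tensor z c).
Proof.
move=> /frame_rotation /rotation_tr ra /frame_rotation rx.
by rewrite -cols_mul_tr; apply: rotation_mul.
Qed.

(** * The vector of a rotation *)

Lemma skew_W M : M^T = - M -> exists a, M = W a.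
Proof.
move=> /matrixP skew.
have e i j : M j i = - M i j by have := skew i j; rewrite !mxE.
have d i : M i i = 0 by apply/eqP; have := e i i; lra.
exists (\col_i [:: M 2 1; M 0 2; M 1 0]`_i).
by apply/matrixP; elim/ord3P; elim/ord3P; rewrite WE ?mxE /= ?d -?e.
Qed.

(** In dimension three det (1 + Q) = 1 + tr Q + tr (adj Q) + det Q.  The columns
    of Q are cross products of one another, so that Q is its own cofactor matrix
    and tr (adj Q) = tr Q. *)
Lemma det_add1_rotation Q : rotation Q -> \det (1%:M + Q) = 2 * (1 + \tr Q).
Proof.
move=> rQ; have f : positive_orthonormal_frame (col 0 Q) (col 1 Q) (col 2 Q).
  by apply/frame_rotation; rewrite cols_col.
have := congr1 (fun x : 'cV_3 => x 2 0) (frame_cross f).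
have := congr1 (fun x : 'cV_3 => x 0 0) (frame_cross (frame_cycle f)).
have := congr1 (fun x : 'cV_3 => x 1 0)
  (frame_cross (frame_cycle (frame_cycle f))).
case: rQ => _; rewrite !crossE /mxtrace sum_ord3 !det3E !mxE /= => d c1 c0 c2.
lra.
Qed.

Lemma W_mulW a : W a *m W a = tensor a a - (dot a a)%:M.
Proof.
apply/matrixP; elim/ord3P; elim/ord3P;
  rewrite mulmx3E !WE dotE !mxE !big_ord1 !mxE /=; ring.
Qed.

Lemma tensor_mulW a : tensor a a *m W a = 0.
Proof.
apply/matrixP; elim/ord3P; elim/ord3P;
  rewrite mulmx3E !WE !mxE !big_ord1 !mxE /=; ring.
Qed.

Lemma add1_dot_neq0 a : 1 + dot a a != 0.
Proof. by rewrite gt_eqF // dotE; nra. Qed.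

(** The Cayley form R(a) = (1 + W a) (1 - W a)^-1, which follows from
    W a ^2 = a (x) a - |a|^2 and (a (x) a) W a = 0. *)
Lemma rotation_ofP a : rotation_of a *m (1%:M - W a) = 1%:M + W a.
Proof.
rewrite /rotation_of -scalemxAl mulmxBr mulmx1 !mulmxDl mul_scalar_mx.
rewrite -!scalemxAl W_mulW tensor_mulW scaler0 addr0.
apply: (canLR (scalerK (add1_dot_neq0 a))).
move: (tensor a a) (W a) (dot a a) => T w d.
by apply/matrixP => i j; rewrite !mxE; case: (i == j); rewrite /=; ring.
Qed.

(** The inverse Cayley transform A = (Q - 1) (1 + Q)^-1 is skew, hence A = W a,
    and [rotation_ofP] gives 2 R(a) = (1 + A) (1 + Q) = 2 Q. *)
Lemma rotation_has_vector Q : rotation Q -> 1 + \tr Q != 0 ->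
  exists a, rotation_of a = Q.
Proof.
move=> rQ tr0; have unitQ : 1%:M + Q \in unitmx.
  by rewrite unitmxE unitfE det_add1_rotation // mulf_neq0 ?pnatr_eq0.
have [QQ _] := rQ.
set A := (Q - 1%:M) *m invmx (1%:M + Q).
have A1Q : A *m (1%:M + Q) = Q - 1%:M by rewrite /A mulmxKV.
have [a Aa] : exists a, A = W a.
  (* Both sides of A^T = - A are compared after multiplication by 1 + Q on the
     left and on the right, where they become 1 - Q^2. *)
  apply: skew_W.
  have QA : (1%:M + Q) *m A^T = 1%:M - Q.
    have := congr1 (fun M => Q *m M^T) A1Q.
    rewrite /= trmx_mul !linearD linearN /= !trmx1 mulmxA !mulmxDr mulmxN.
    by rewrite !mulmx1 (mulmx1C QQ) [Q + _]addrC.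
  apply: (can_inj (mulKmx unitQ)); apply: (can_inj (mulmxK unitQ)).
  rewrite QA mulmxN mulNmx -mulmxA A1Q.
  rewrite !(mulmxDl, mulmxDr, mulmxN, mulNmx, mulmx1, mul1mx).
  move: (Q *m Q) => QQ'.
  by apply/matrixP => i j; rewrite !mxE; ring.
exists a.
have := congr1 (mulmx^~ (1%:M + Q)) (rotation_ofP a).
rewrite -Aa /= -mulmxA mulmxBl mulmxDl A1Q mul1mx opprB.
rewrite [X in _ *m X](_ : _ = 2%:M); last first.
  by apply/matrixP => i j; rewrite !mxE; case: (i == j); rewrite /=; ring.
rewrite mul_mx_scalar [RHS](_ : _ = 2 *: Q).
  by apply: scalerI; rewrite pnatr_eq0.
by apply/matrixP => i j; rewrite !mxE; ring.
Qed.

Lemma rotation_of_mul a x : rotation_of a *m x =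
  (1 + dot a a)^-1 *:
    ((1 - dot a a) *: x + (2 * dot a x) *: a + 2 *: cross a x).
Proof.
rewrite -scalemxAl !mulmxDl mul_scalar_mx -!scalemxAl W_mul tensor_mul.
by rewrite scalerA.
Qed.

Lemma dot_cross a b c : dot (cross a b) c = dot a (cross b c).
Proof. by rewrite !dotE !crossE; ring. Qed.

Lemma dot0r a : dot a 0 = 0.
Proof. by rewrite dotE !coordE; ring. Qed.

(** * Bending part and polar rotation *)

(** Let a1, a2, a3 be the coordinates of a in the frame.  Then
    n1 = 2 (a1 a3 + a2) / (1 + |a|^2) and n2 = 2 (a2 a3 - a1) / (1 + |a|^2),
    while the bending part has coordinates (a1 - a3 a2) / (1 + a3^2) and
    (a2 + a3 a1) / (1 + a3^2), and 1 + n3 = 2 (1 + a3^2) / (1 + |a|^2). *)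
Lemma bending_part_rotation e1 e2 e3 a (n := rotation_of a *m e3) :
  positive_orthonormal_frame e1 e2 e3 ->
  1 + dot n e3 != 0 /\
  bending_part e3 a = (1 + dot n e3)^-1 *: (- dot n e2 *: e1 + dot n e1 *: e2).
Proof.
move=> f; have c12 := frame_cross f; have c23 := frame_cross (frame_cycle f).
have c31 := frame_cross (frame_cycle (frame_cycle f)).
have [[n1 n2 n3] [[h12 h13 h23] _]] := f.
have k0 := add1_dot_neq0 a.
have n_e x : dot n x = (1 + dot a a)^-1 * ((1 - dot a a) * dot e3 x
    + 2 * dot a e3 * dot a x + 2 * dot a (cross e3 x)).
  by rewrite /n rotation_of_mul !(dotZl, dotDl) dot_cross.
have a3 : 1 + dot a e3 ^+ 2 != 0 by rewrite gt_eqF //; nra.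
have n_e3 : 1 + dot n e3 = 2 * (1 + dot a e3 ^+ 2) / (1 + dot a a).
  by rewrite n_e n3 cross_self dot0r; field.
split; first by rewrite n_e3 !mulf_neq0 ?invr_eq0 ?pnatr_eq0.
have [h31 h32] : dot e3 e1 = 0 /\ dot e3 e2 = 0 by rewrite dotC h13 dotC.
rewrite n_e3 !n_e c31 (crossC e3) c23 h31 h32.
rewrite dotNr /bending_part mulmxBl tensor_mul mul1mx.
rewrite [X in X - _](frame_expand a f) (dotC e3 a) addrK.
rewrite mulmxDl mul1mx -scalemxAl W_mul crossDr !crossZr c31 (crossC e3) c23.
rewrite (dotC e1) (dotC e2) -scaleN1r.
move: k0 a3; move: (dot a a) (dot a e1) (dot a e2) (dot a e3) => k x y z k0 z0.
apply: colvec3P; rewrite !coordE; field; by rewrite k0 z0.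
Qed.

Lemma tr_tensor a b : (tensor a b)^T = tensor b a.
Proof. by rewrite /tensor trmx_mul trmxK. Qed.

Lemma mul_tensor M a b : M *m tensor a b = tensor (M *m a) b.
Proof. by rewrite /tensor mulmxA. Qed.

Lemma tensorZl k a b : tensor (k *: a) b = k *: tensor a b.
Proof. by rewrite /tensor -scalemxAl. Qed.

(** The vector y = U e - l e lies in the plane and satisfies U y = - l y, so
    that a nonzero y would contradict the positivity of U. *)
Lemma stretch_eigen e3 U e (l : R) : planar_stretch e3 U -> 0 < l ->
  dot e e3 = 0 -> U *m (U *m e) = l ^+ 2 *: e -> U *m e = l *: e.
Proof.
move=> [symU U3 posU] l0 ee3 UU.
apply/eqP; rewrite -subr_eq0; apply: contraT => y0.
have y3 : dot (U *m e - l *: e) e3 = 0.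
  by rewrite dotDl dotNl dotZl dot_mul symU U3 dot0r ee3; ring.
have Uy : U *m (U *m e - l *: e) = - l *: (U *m e - l *: e).
  rewrite mulmxBr UU -scalemxAr; apply: colvec3P; rewrite !coordE; ring.
have := posU _ y3 y0; rewrite Uy dotZr.
by have := dot_gt0 y0; nra.
Qed.

(** For the gradient of a conformal map with factor l, U is l times the
    projection on the plane; the rotation therefore sends the frame to
    (p / l, q / l, (p x q) / l^2). *)
Lemma conformal_polar e1 e2 e3 p q (l : R)
    (Q := polar_rotation e3 (tensor p e1 + tensor q e2)) :
  positive_orthonormal_frame e1 e2 e3 ->
  0 < l -> dot p p = l ^+ 2 -> dot q q = l ^+ 2 -> dot p q = 0 ->
  rotation Q /\ Q *m e3 = (l ^+ 2)^-1 *: cross p q.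
Proof.
move=> f l0 pp qq pq; have [[n1 n2 n3] [[h12 h13 h23] _]] := f.
have l_neq0 := lt0r_neq0 l0.
(* Existence of a polar decomposition, so that the chosen Q is one. *)
have [] : rotation Q /\ exists U,
    planar_stretch e3 U /\ tensor p e1 + tensor q e2 = Q *m U.
  apply: (@getPex _ [set Q | rotation Q /\ _]).
  exists (tensor (l^-1 *: p) e1 + tensor (l^-1 *: q) e2
        + tensor (cross (l^-1 *: p) (l^-1 *: q)) e3).
  split.
    apply: (frame_to_frame f); apply: orthonormal_pair_frame;
      by rewrite dotZl dotZr ?pp ?qq ?pq; field.
  exists (l *: (tensor e1 e1 + tensor e2 e2)); split.
    split.
    - by rewrite linearZ linearD /= !tr_tensor.
    - by rewrite -scalemxAl mulmxDl !tensor_mul h13 h23 !scale0r addr0 scaler0.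
    - move=> v v3 v0; rewrite -scalemxAl mulmxDl !tensor_mul.
      have := frame_expand v f; rewrite (dotC e3) v3 scale0r addr0 => <-.
      by rewrite dotZr mulr_gt0 // dot_gt0.
  rewrite -scalemxAr mulmxDr !mul_tensor !mulmxDl !tensor_mul n1 n2.
  rewrite (dotC e2 e1).
  rewrite (dotC e3 e1) (dotC e3 e2) h12 h13 h23 !scale0r !addr0 !add0r !scale1r.
  by rewrite !tensorZl -scalerDr scalerA divff // scale1r.
move=> rQ [U [stU QU]]; split=> //.
have [QQ _] := rQ; have [symU _ _] := stU.
have UU : U *m U = l ^+ 2 *: (tensor e1 e1 + tensor e2 e2).
  have : U *m U = (Q *m U)^T *m (Q *m U).
    by rewrite trmx_mul symU mulmxA -(mulmxA U) QQ mulmx1.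
  rewrite -QU [(_ + _)^T]linearD /= !tr_tensor mulmxDr !mul_tensor.
  rewrite !mulmxDl !tensor_mul.
  by rewrite pp qq (dotC q p) pq !scale0r addr0 add0r !tensorZl -scalerDr => ->.
have U1 : U *m e1 = l *: e1.
  apply: (stretch_eigen stU) => //.
  rewrite mulmxA UU -scalemxAl mulmxDl !tensor_mul n1 (dotC e2) h12.
  by rewrite scale0r addr0 scale1r.
have U2 : U *m e2 = l *: e2.
  apply: (stretch_eigen stU) => //.
  rewrite mulmxA UU -scalemxAl mulmxDl !tensor_mul n2 h12.
  by rewrite scale0r add0r scale1r.
have Q1 : Q *m e1 = l^-1 *: p.
  have := congr1 (mulmx^~ e1) QU; rewrite /= -mulmxA U1 mulmxDl !tensor_mul n1.
  rewrite (dotC e2) h12 scale0r addr0 scale1r -scalemxAr => ->.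
  by rewrite scalerA mulVf // scale1r.
have Q2 : Q *m e2 = l^-1 *: q.
  have := congr1 (mulmx^~ e2) QU; rewrite /= -mulmxA U2 mulmxDl !tensor_mul n2.
  rewrite h12 scale0r add0r scale1r -scalemxAr => ->.
  by rewrite scalerA mulVf // scale1r.
rewrite -(frame_cross (rotation_frame rQ f)) Q1 Q2 crossZl crossZr scalerA.
by rewrite -invfM expr2.
Qed.

End Coordinates.

(** * Real derivatives along lines of complex differentiable functions *)

Section Lines.
Variable R : realType.
Implicit Types (w d g k z : CC R).

Lemma cvg_Re (T : Type) (A : set_system T) {FA : Filter A}
    (f : T -> CC R) z :
  f @ A --> z -> complex.Re (f t) @[t --> A] --> (complex.Re z : R).
Proof.
move=> fz; apply/cvgrPdist_lt => e e0.
have eC : (0 : R[i]) < e%:C by rewrite ltcR.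
have ft : \forall t \near A, `|z - f t| < e%:C.
  exact: (cvgr_dist_lt _ _ fz).
near=> t.
have H := normc_ge_Re (z - f t).
rewrite -raddfB -ltcR; apply: (le_lt_trans H).
by near: t.
Unshelve. all: by end_near.
Qed.

Lemma real_line_cvg d : (h%:C * d : CC R) @[h --> (0 : R)] --> (0 : CC R).
Proof.
apply/cvgrPdist_lt => e e0.
have d1 : (0 : R[i]) < 1 + `|d| by rewrite ltr_pwDl.
have [x ex] : exists x, e / (1 + `|d|) = x%:C.
  exists (complex.Re (e / (1 + `|d|))).
  by rewrite RRe_real // gtr0_real // divr_gt0.
have x0 : 0 < x by rewrite -ltcR -ex divr_gt0.
near=> h.
rewrite sub0r normrN normrM -[e](divfK (lt0r_neq0 d1)) ex.
apply: le_lt_trans (_ : `|h%:C| * (1 + `|d|) < _).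
  by rewrite ler_wpM2l // lerDr.
rewrite ltr_pM2r // normc_def /= expr0n addr0 sqrtr_sqr ltcR.
near: h; exact: (@nbhs0_lt R R^o).
Unshelve. all: by end_near.
Qed.

Lemma real_line_cvg_dnbhs d : d != 0 ->
  (h%:C * d : CC R) @[h --> (0 : R)^'] --> (0 : CC R)^'.
Proof.
move=> d0 A A0.
have {}A0 : \forall z \near (0 : CC R), z != 0 -> A z by [].
have := nbhs_dnbhs (real_line_cvg d A0).
have := nbhs_dnbhs_neq (0 : R).
apply: filterS2 => h h0; apply.
by rewrite mulf_neq0 // (inj_eq (@complexI _) h 0).
Qed.

(** The complex difference quotient is taken at the increment h d, with h real,
    and multiplied by k d; its real part is the real difference quotient. *)
Lemma line_derivative (G : CC R -> CC R) w d g k :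
  is_derive w 1 G g -> d != 0 ->
  h^-1 * (complex.Re (k * G (h%:C * d + w)) - complex.Re (k * G w))
    @[h --> (0 : R)^'] --> (complex.Re (k * d * g) : R).
Proof.
move=> dG d0.
have Gg : z^-1 *: (G (z *: 1 + w) - G w) @[z --> (0 : CC R)^'] --> g.
  by case: dG => exG <-.
have Gd := cvg_comp _ _ (real_line_cvg_dnbhs d0) Gg.
have kd : (k * d) *: ((h%:C * d)^-1 *: (G ((h%:C * d) *: 1 + w) - G w))
   @[h --> (0 : R)^'] --> (k * d * g : CC R).
  exact: cvgZl_tmp Gd.
apply: cvg_trans (cvg_Re kd); apply: near_eq_cvg.
near=> h.
have h0 : h != 0 by near: h; exact: nbhs_dnbhs_neq.
have hC : h%:C != 0 :> R[i] by rewrite (inj_eq (@complexI _) h 0).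
have -> : (k * d) *: ((h%:C * d)^-1 *: (G ((h%:C * d) *: 1 + w) - G w))
   = (h^-1)%:C * (k * G (h%:C * d + w) - k * G w) :> R[i].
  rewrite /GRing.scale /= mulr1 fmorphV /=; field.
  by rewrite hC d0.
rewrite -raddfB /=; case: (k * _ - _) => x y /=; ring.
Unshelve. all: by end_near.
Qed.

End Lines.

(** * Weierstrass surfaces *)

Section Weierstrass.
Variables (R : realType) (e1 e2 e3 : 'cV[R]_3).
Hypothesis frame : positive_orthonormal_frame e1 e2 e3.

Definition in_frame (x y z : R) : 'cV[R]_3 := x *: e1 + y *: e2 + z *: e3.

Lemma dot_in_frame x y z x' y' z' :
  dot (in_frame x y z) (in_frame x' y' z') = x * x' + y * y' + z * z'.
Proof.
have [[n1 n2 n3] [[h12 h13 h23] _]] := frame.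
rewrite /in_frame !(dotDl, dotDr, dotZl, dotZr) (dotC e2 e1) (dotC e3 e1).
by rewrite (dotC e3 e2) n1 n2 n3 h12 h13 h23; ring.
Qed.

Lemma cross_in_frame x y z x' y' z' :
  cross (in_frame x y z) (in_frame x' y' z') =
  in_frame (y * z' - z * y') (z * x' - x * z') (x * y' - y * x').
Proof.
have c12 := frame_cross frame; have c23 := frame_cross (frame_cycle frame).
have c31 := frame_cross (frame_cycle (frame_cycle frame)).
rewrite /in_frame !(crossDl, crossDr, crossZl, crossZr) !cross_self.
rewrite (crossC e2 e1) (crossC e1 e3) (crossC e3 e2) c12 c23 c31.
by apply: colvec3P; rewrite !coordE; ring.
Qed.

Lemma in_frame_coords x y z (n := in_frame x y z) :
  (dot n e1 = x) * (dot n e2 = y) * (dot n e3 = z).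
Proof.
have [[n1 n2 n3] [[h12 h13 h23] _]] := frame.
repeat split; rewrite /n /in_frame !(dotDl, dotZl) ?(dotC e2 e1) ?(dotC e3);
  by rewrite ?n1 ?n2 ?n3 ?h12 ?h13 ?h23; ring.
Qed.

Variables (Omega : set (CC R)) (F : CC R -> CC R) (r : CC R -> 'cV[R]_3).
Hypotheses (openO : open Omega) (Wr : weierstrass_surface Omega F e1 e2 e3 r).

(** The derivative of r at w along the direction d, each complex primitive
    contributing its derivative times d. *)
Definition velocity (w d : CC R) : 'cV[R]_3 :=
  in_frame (complex.Re (2^-1 * d * ((1 - w ^+ 2) * F w)))
           (complex.Re ('i%C / 2 * d * ((1 + w ^+ 2) * F w)))
           (complex.Re (1 * d * (w * F w))).

Lemma complex_half : 2^-1 = (2^-1 : R)%:C :> R[i].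
Proof. by rewrite fmorphV rmorphD. Qed.

Lemma open_line (w d : CC R) : Omega w ->
  \forall h \near (0 : R)^', Omega (h%:C * d + w).
Proof.
move=> Ow; apply: nbhs_dnbhs.
have : (h%:C * d + w : CC R) @[h --> (0 : R)] --> (0 + w : CC R).
  by apply: cvgD; [exact: real_line_cvg|exact: cvg_cst].
by rewrite add0r; apply; exact: open_nbhs_nbhs.
Qed.

Lemma surface_velocity w d : Omega w -> d != 0 ->
  h^-1 *: (r (h%:C * d + w) - r w) @[h --> (0 : R)^'] --> velocity w d.
Proof.
move=> Ow d0; have [G1 [G2 [G3 [dG1 dG2 dG3 rE]]]] := Wr.
have c1 := line_derivative (k := 2^-1) (dG1 _ Ow) d0.
have c2 := line_derivative (k := 'i%C / 2) (dG2 _ Ow) d0.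
have c3 := line_derivative (k := 1) (dG3 _ Ow) d0.
apply: cvg_trans (cvgD (cvgD (cvgZr_tmp (a := e1) c1) (cvgZr_tmp (a := e2) c2))
  (cvgZr_tmp (a := e3) c3)).
apply: near_eq_cvg; near=> h.
have Oh : Omega (h%:C * d + w) by near: h; exact: open_line.
rewrite /= (rE _ Oh) (rE _ Ow).
by apply: colvec3P; rewrite !coordE !mul1r; ring.
Unshelve. all: by end_near.
Qed.

Lemma gradient_velocity w : Omega w ->
  gradient e1 e2 r w = tensor (velocity w 1) e1 + tensor (velocity w 'i%C) e2.
Proof.
move=> Ow; rewrite /gradient /derive1.
have d1 : (1 : CC R) != 0 by exact: oner_neq0.
have d2 : ('i%C : CC R) != 0 by rewrite eq_complex /= eqxx oner_eq0.
congr (tensor _ _ + tensor _ _); apply: cvg_lim => //.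
  rewrite [X in X @ _ --> _](_ : _ = fun h : R =>
    h^-1 *: (r (h%:C * 1 + w) - r w)).
    exact: surface_velocity.
  apply/funext => h; case: w Ow => u v _ /=; congr (_ *: (r _ - _)).
  by apply/eqP; rewrite eq_complex /=; apply/andP; split; apply/eqP; ring.
rewrite [X in X @ _ --> _](_ : _ = fun h : R =>
  h^-1 *: (r (h%:C * 'i%C + w) - r w)).
  exact: surface_velocity.
apply/funext => h; case: w Ow => u v _ /=; congr (_ *: (r _ - _)).
by apply/eqP; rewrite eq_complex /=; apply/andP; split; apply/eqP; ring.
Qed.

(** The normal is the inverse stereographic projection of w: with F w = f + i g
    and l = |F w| (1 + |w|^2) / 2, the partial derivatives have length l, and
    the entries of their cross product are multiples of f^2 + g^2. *)
Lemma surface_rotation_normal u v (m := u ^+ 2 + v ^+ 2)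
    (Q := surface_rotation e1 e2 e3 r (u +i* v)) :
  Omega (u +i* v) -> F (u +i* v) != 0 ->
  rotation Q /\
  Q *m e3 = (1 + m)^-1 *: in_frame (2 * u) (2 * v) (m - 1).
Proof.
move=> Ow; rewrite /Q /surface_rotation (gradient_velocity Ow) /velocity.
case: (F _) => f g F0.
have fg : 0 < f ^+ 2 + g ^+ 2.
  have : (f == 0) && (g == 0) = false.
    by move: F0; rewrite eq_complex => /negbTE.
  rewrite -(sqrf_eq0 f) -(sqrf_eq0 g) -paddr_eq0 ?sqr_ge0 // lt0r => ->.
  by rewrite addr_ge0 ?sqr_ge0.
set p := in_frame _ _ _; set q := in_frame _ _ _.
have pE : p = in_frame (((1 - u ^+ 2 + v ^+ 2) * f + 2 * u * v * g) / 2)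
   (- ((1 + u ^+ 2 - v ^+ 2) * g + 2 * u * v * f) / 2) (u * f - v * g).
  rewrite /p !expr2 complex_half; congr in_frame; rewrite /=; ring.
have qE : q = in_frame (- ((1 - u ^+ 2 + v ^+ 2) * g - 2 * u * v * f) / 2)
   (- ((1 + u ^+ 2 - v ^+ 2) * f - 2 * u * v * g) / 2) (- (u * g + v * f)).
  rewrite /q !expr2 complex_half; congr in_frame; rewrite /=; ring.
pose l := Num.sqrt (f ^+ 2 + g ^+ 2) * (1 + m) / 2.
have m1 : 0 < 1 + m by rewrite /m; nra.
have l2 : l ^+ 2 = (f ^+ 2 + g ^+ 2) * (1 + m) ^+ 2 / 4.
  by rewrite /l !exprMn sqr_sqrtr ?ltW //; field.
have l0 : 0 < l by rewrite /l !mulr_gt0 ?sqrtr_gt0 ?invr_gt0.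
have [||| rQ ->] := conformal_polar (p := p) (q := q) frame l0.
- by rewrite l2 pE dot_in_frame /m; field.
- by rewrite l2 qE dot_in_frame /m; field.
- by rewrite pE qE dot_in_frame; field.
split=> //; rewrite pE qE cross_in_frame l2.
move: m1 fg => /lt0r_neq0 m1 /lt0r_neq0 fg.
apply: colvec3P; rewrite !coordE /m; field; by rewrite m1 fg.
Qed.

End Weierstrass.

Lemma cexp_neq0 (R : realType) (z : R[i]) : cexp z != 0.
Proof.
apply: mulf_neq0.
  by rewrite (inj_eq (@complexI _) _ 0) lt0r_neq0 // expR_gt0.
apply/eqP => -[c0 s0]; have := cos2Dsin2 (complex.Im z).
by rewrite c0 s0 !expr0n addr0 => /esym/eqP; rewrite oner_eq0.
Qed.

Theorem mainTheorem3 (R : realType) (e1 e2 e3 : 'cV[R]_3)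
    (Omega : set (CC R)) (F : CC R -> CC R) (Phi chi : CC R -> R)
    (r : CC R -> 'cV[R]_3) :
  positive_orthonormal_frame e1 e2 e3 ->
  open Omega ->
  simply_connected Omega ->
  holomorphic_on Omega F ->
  (forall w, Omega w -> F w = cexp (Phi w +i* chi w)) ->
  weierstrass_surface Omega F e1 e2 e3 r ->
  forall u v : R,
    Omega (u +i* v) ->
    1 + \tr (surface_rotation e1 e2 e3 r (u +i* v)) != 0 ->
    bending_content e1 e2 e3 r (u +i* v)
      = (u ^+ 2 + v ^+ 2)^-1 *: (- v *: e1 + u *: e2).
Proof.
move=> frame openO _ _ Fexp Wr u v Ow tr0.
have F0 : F (u +i* v) != 0 by rewrite (Fexp _ Ow) cexp_neq0.
have [rQ Qe3] := surface_rotation_normal frame openO Wr Ow F0.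
have := getPex (rotation_has_vector rQ tr0).
rewrite -/(rotation_vector _) => aQ.
rewrite /bending_content; set a := rotation_vector _ in aQ *.
have [] := bending_part_rotation a frame.
rewrite aQ Qe3 !dotZl !(in_frame_coords frame) => n3 ->.
have m1 : 1 + (u ^+ 2 + v ^+ 2) != 0 by rewrite gt_eqF //; nra.
(* At w = 0 the normal would be - e3, against 1 + n3 <> 0. *)
have m0 : u ^+ 2 + v ^+ 2 != 0.
  by apply: contraNN n3 => /eqP ->; apply/eqP; field.
have -> : 1 + (1 + (u ^+ 2 + v ^+ 2))^-1 * (u ^+ 2 + v ^+ 2 - 1)
    = 2 * (u ^+ 2 + v ^+ 2) / (1 + (u ^+ 2 + v ^+ 2)) by field.
by apply: colvec3P; rewrite !coordE; field; rewrite m0 m1.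
Qed.
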